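(* Let $X$ be a real Banach space and let $f:\mathbb{R}\to X$ be arbitrary. Then there exists a set $M\subset\mathbb{R}$ of Lebesgue measure zero such that: if $x\in\mathbb{R}\setminus M$ and $\min(mD^-(f,x),mD^+(f,x))<\infty$, then $f$ is metrically differentiable at $x$.
   Context: For $f:\mathbb{R}\to X$ and $x\in\mathbb{R}$: $mD^{\pm}(f,x)=\limsup_{t\to0+}\frac{\|f(x\pm t)-f(x)\|}{t}\in[0,+\infty]$. The unilateral metric derivatives are $md_{\pm}(f,x)=\lim_{t\to0+}\frac{\|f(x\pm t)-f(x)\|}{t}$; if both exist and are equal (and finite), their common value is the metric derivative $md(f,x)$. The mapping $f$ is metrically differentiable at $x$ if $md(f,x)$ exists and $\|f(y)-f(z)\|-md(f,x)|y-z|=o(|y-x|+|z-x|)$ as $(y,z)\to(x,x)$. *)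

(* Defs.v *)
From HB Require Import structures.
From mathcomp Require Import all_boot all_order all_algebra.
From mathcomp Require Import all_classical all_reals all_analysis.

Set Implicit Arguments.
Unset Strict Implicit.
Unset Printing Implicit Defensive.

Import Order.TTheory GRing.Theory Num.Theory.
Import numFieldNormedType.Exports.

Local Open Scope classical_set_scope.
Local Open Scope ring_scope.

Section metric_derivatives.
Context {R : realType} {X : normedModType R}.
Implicit Types (f : R -> X) (x : R).

Definition metric_quotient_right f x (t : R) : R := `|f (x + t) - f x| / t.
Definition metric_quotient_left f x (t : R) : R := `|f (x - t) - f x| / t.

Definition mD_right f x : \bar R :=
  limf_esup (fun t => (metric_quotient_right f x t)%:E) 0^'+.
Definition mD_left f x : \bar R :=
  limf_esup (fun t => (metric_quotient_left f x t)%:E) 0^'+.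

(* The unilateral limits may a priori be infinite; [is_md] below is the case
   where they agree on a finite value. *)
Definition is_md_right f x (l : \bar R) : Prop :=
  (metric_quotient_right f x t)%:E @[t --> 0^'+] --> l.
Definition is_md_left f x (l : \bar R) : Prop :=
  (metric_quotient_left f x t)%:E @[t --> 0^'+] --> l.

Definition is_md f x (l : R) : Prop :=
  is_md_right f x l%:E /\ is_md_left f x l%:E.

(* The little-o is along the full neighborhood filter of [(x, x)] in the
   product space [R * R]. *)
Definition metrically_differentiable f x : Prop :=
  exists l : R, is_md f x l /\
    (fun p : R * R => `|f p.1 - f p.2| - l * `|p.1 - p.2|)
      =o_ (nbhs (x, x)) (fun p : R * R => `|p.1 - x| + `|p.2 - x|).

End metric_derivatives.

(* Main.v *)
(**
Let A be the set of points x in a short interval such that, for all small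
t > 0, |f (x + s t) - f x| <= L t, where s = 1 or s = -1 is fixed. Countably
many such sets cover the points where one of the two upper metric derivatives
is finite, and f is L-Lipschitz on each of them.

Along A, f is metrically differentiable almost everywhere: for a sequence d_k
dense in A, extend a |-> |f a - f (d_k)| from A to a real Lipschitz function on
R (McShane). By the Radon-Nikodym theorem it is the integral of a bounded
density h_k. Put m := sup_k |h_k|. Then |f a - f b| is at most the integral of m
between a and b, so the metric derivative at a Lebesgue point is at most m; it
is at least each |h_k| at a Lebesgue point of h_k.

The distance to A is Lipschitz as well, and its derivative can only vanish on A,
so near almost every x in A each y has a point a of A, on the prescribed side
of y, with |y - a| = o(|y - x|), hence |f y - f a| = o(|y - x|). This transfers
metric differentiability from A to a full neighborhood of x.
*)
Require Import Defs.
From HB Require Import structures.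
From mathcomp Require Import all_boot all_order all_algebra.
From mathcomp Require Import all_classical all_reals all_analysis.
From mathcomp Require Import measurable_realfun lra.

Import Order.TTheory GRing.Theory Num.Theory.
Import numFieldNormedType.Exports.

Local Open Scope classical_set_scope.
Local Open Scope ring_scope.

(** * Lipschitz functions as integrals of bounded densities *)

Section lipschitz_density.
Context {R : realType}.
Local Notation mu := (@lebesgue_measure R).

(** Both measures are infima over the same countable covers by half-open intervals, and on one such
    interval the bound is the Lipschitz condition. *)
Lemma lebesgue_stieltjes_le_lipschitz (F : cumulative R R) (L : R) (A : set R) :
  0 < L -> (forall s t, s <= t -> F t - F s <= L * (t - s)) ->
  (lebesgue_stieltjes_measure F A <= L%:E * mu A)%E.
Proof.
move=> L0 FL; rewrite -lee_pdivrMl//.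
apply: le_ereal_inf_tmp => _ [B [mB AB] <-].
rewrite lee_pdivrMl//.
apply: (@le_trans _ _ (\sum_(k <oo) wlength F (B k))%E).
  by apply: ereal_inf_lbound; exists B.
rewrite -nneseriesZl; last by move=> *; exact: wlength_ge0.
apply: lee_nneseries => [k _ _|k _]; first exact: wlength_ge0.
have [[a b] _ /= <-] := mB k; have [ab|ba] := leP a b.
  by rewrite !wlength_itv_bnd// -EFinM lee_fin FL.
rewrite set_itv_ge; last by rewrite bnd_simp -leNgt ltW.
by rewrite !wlength0 mule0.
Qed.

Lemma lipschitz_continuous (F : R -> R) (L : R) :
  (forall s t, `|F t - F s| <= L * `|t - s|) -> continuous F.
Proof.
move=> FL x; apply/cvgrPdist_le => /= e e0.
have L1 : 0 < `|L| + 1 by rewrite ltr_wpDl.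
near=> y; rewrite distrC.
apply: (le_trans (FL x y)).
apply: (@le_trans _ _ ((`|L| + 1) * `|y - x|)).
  by rewrite ler_wpM2r// (le_trans (ler_norm _))// lerDl.
rewrite -ler_pdivlMl// distrC.
by near: y; apply: cvgr_dist_le => //; rewrite mulr_gt0// invr_gt0.
Unshelve. all: by end_near. Qed.

(** The Lebesgue-Stieltjes measure of [F] is at most [L] times Lebesgue measure, hence absolutely
    continuous; [h] is its Radon-Nikodym density, cut off at [L]. *)
Lemma nondecreasing_lipschitz_density (F : R -> R) (L p q : R) :
  0 < L -> {homo F : s t / s <= t} ->
  (forall s t, s <= t -> F t - F s <= L * (t - s)) ->
  exists h : R -> R, [/\ measurable_fun setT h,
    forall x, 0 <= h x <= L &
    forall a b, p <= a -> a <= b -> b <= q ->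
      (\int[mu]_(x in `]a, b]) (h x)%:E = (F b - F a)%:E)%E].
Proof.
move=> L0 ndF FL.
have rcF : right_continuous F.
  apply/right_continuousW/(@lipschitz_continuous F L) => s t.
  have [st|/ltW ts] := leP s t; last first.
    by rewrite distrC (distrC t) !ger0_norm ?subr_ge0 ?ndF// FL.
  by rewrite !ger0_norm ?subr_ge0 ?ndF// FL.
pose Fc : cumulative R R :=
  HB.pack F (isCumulative.Build R _ R F ndF rcF).
pose nu0 := lebesgue_stieltjes_measure Fc.
have nu0le A : (nu0 A <= L%:E * mu A)%E.
  exact: lebesgue_stieltjes_le_lipschitz.
(* Restriction to a bounded interval makes the Stieltjes measure finite. *)
pose D := `]p, q]%classic : set (measurableTypeR R).
have mD : measurable D by exact: measurable_itv.
have nu0D : (nu0 D < +oo)%E.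
  apply: (le_lt_trans (nu0le D)).
  rewrite lebesgue_measure_itv/=; case: ifP => _; last by rewrite mule0 ltry.
  by rewrite -EFinB -EFinM ltry.
pose nu : {finite_measure set (measurableTypeR R) -> \bar R} := mfrestr mD nu0D.
have numu : nu `<< mu.
  apply/null_content_dominatesP => A mA A0.
  apply/eqP; rewrite eq_le measure_ge0 andbT.
  apply: (@le_trans _ _ (nu0 A)).
    apply: le_measure; rewrite ?inE//; exact: measurableI.
  by rewrite (le_trans (nu0le A))// A0 mule0.
have [h [h_ge0 mh hE]] : exists h : R -> R,
    [/\ forall x, 0 <= h x, measurable_fun setT h &
     forall A : set R, measurable A -> nu A = (\int[mu]_(x in A) (h x)%:E)%E].
  have [h0 [h0ge h0fin inth0 hE]] := radon_nikodym_sigma_finite numu.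
  exists (fine \o h0); split.
  - by move=> x; rewrite fine_ge0.
  - have mh0 := measurable_int _ inth0.
    exact: (measurableT_comp (fine_measurable measurableT) mh0).
  - by move=> A mA; rewrite hE//; apply: eq_integral => x _; rewrite fineK.
(* The density exceeds [L] only on a null part of [D]: on [S] its integral is [nu S], at most [L]
   times [mu S], so the positive function [h - L] integrates to zero there. Intersecting with [D]
   keeps [mu S] finite, so that it can be added to both sides. *)
pose E := [set x | L < h x].
have mE : measurable E.
  rewrite -[E]setTI (_ : E = h @^-1` `]L, +oo[%classic).
    by apply: mh => //; exact: measurable_itv.
  by apply/seteqP; split => x /=; rewrite /E /= in_itv/= andbT.
pose S := E `&` D.
have mS : measurable S by exact: measurableI.
have muS : (mu S < +oo)%E.
  apply: (@le_lt_trans _ _ (mu D)); first by rewrite le_measure ?inE//; exact: subIsetr.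
  by rewrite lebesgue_measure_itv/=; case: ifP => _ //; rewrite -EFinB ltry.
have mg : measurable_fun S (fun x => (h x - L)%:E).
  apply/measurable_EFinP/measurable_funB => //.
  exact: measurable_funS mh.
have intg : (\int[mu]_(x in S) `|(h x - L)%:E| = 0)%E.
  apply/eqP; rewrite eq_le integral_ge0 ?andbT//.
  rewrite -(@leeD2rE _ (L%:E * mu S)%E); last first.
    by rewrite fin_numM// ge0_fin_numE.
  rewrite add0e -integral_cst// -ge0_integralD//; last 2 first.
    exact: measurableT_comp.
    by move=> x Sx; rewrite lee_fin; exact: ltW.
  have -> : (\int[mu]_(x in S) (`|(h x - L)%:E| + cst L%:E x) =
             \int[mu]_(x in S) (h x)%:E)%E.
    apply: eq_integral => x; rewrite inE => -[Ex _].
    by rewrite gee0_abs ?lee_fin ?subr_ge0 1?ltW//= -EFinD subrK.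
  rewrite -hE// integral_cst//= /mfrestr /mrestr.
  apply: le_trans (nu0le _) _.
  by rewrite lee_pmul2l// le_measure// ?inE//; exact: measurableI.
have negS : mu.-negligible S.
  have /(ae_eq_integral_abs mu mS mg) := intg.
  apply: negligibleS => x [Ex Dx] /=; apply/not_implyP; split => //.
  by case=> /eqP; rewrite subr_eq0 gt_eqF.
exists (fun x => Num.min (h x) L); split.
- exact: measurable_minr.
- move=> x; rewrite le_min ge_min lexx orbT andbT (ltW L0) andbT.
  exact: h_ge0.
move=> a b pa ab bq.
have abD : `]a, b]%classic `<=` D.
  apply: subset_itv; rewrite bnd_simp//.
transitivity (\int[mu]_(x in `]a, b]) (h x)%:E)%E; last first.
  rewrite -hE//= /mfrestr /mrestr setIidl//.
  rewrite /nu0 /lebesgue_stieltjes_measure /measure_extension measurable_mu_extE/=.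
    by rewrite wlength_itv_bnd.
  exact: is_ocitv.
apply: ae_eq_integral => //.
- apply: measurable_funS (measurableT) _ _ => //.
  by apply/measurable_EFinP; exact: measurable_minr.
- by apply/measurable_EFinP; exact: measurable_funS mh.
apply: negligibleS negS => x /= /not_implyP[abx hx]; split; last exact: abD.
rewrite /E/= ltNge; apply/negP => hL; apply: hx.
by rewrite min_l.
Qed.

Lemma bounded_integrable (A : set R) (h : R -> R) (L : R) :
  measurable A -> (mu A < +oo)%E -> measurable_fun setT h ->
  (forall x, `|h x| <= L) -> mu.-integrable A (EFin \o h).
Proof.
move=> mA Aoo mh hL; apply: measurable_bounded_integrable => //.
  exact: measurable_funS mh.
exists L; split; first by rewrite num_real.
by move=> M LM x _; exact: le_trans (hL x) (ltW LM).
Qed.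

Lemma lebesgue_measure_itvoc (a b : R) : a <= b -> mu `]a, b] = (b - a)%:E.
Proof.
move=> ab; rewrite lebesgue_measure_itv/= lte_fin; case: ltP => //.
by move=> ba; have -> : a = b; [apply/eqP; rewrite eq_le ab|rewrite subrr].
Qed.

(** Adding [L * t] makes [F] nondecreasing with increments at most [2 L] times the step; subtracting
    [L] from the resulting density, which lies between 0 and [2 L], undoes this. *)
Lemma lipschitz_density (F : R -> R) (L p q : R) :
  0 < L -> (forall s t, `|F t - F s| <= L * `|t - s|) ->
  exists h : R -> R, [/\ measurable_fun setT h,
    forall x, `|h x| <= L &
    forall a b, p <= a -> a <= b -> b <= q ->
      \int[mu]_(x in `]a, b]) h x = F b - F a].
Proof.
move=> L0 FL.
have [] := @nondecreasing_lipschitz_density (fun t => F t + L * t) (L *+ 2) p q.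
- by rewrite mulrn_wgt0.
- move=> s t st; rewrite -subr_ge0.
  have := FL s t; rewrite [X in _ * X]ger0_norm ?subr_ge0// ler_norml => /andP[+ _].
  by move=> ?; lra.
- move=> s t st.
  have := FL s t; rewrite [X in _ * X]ger0_norm ?subr_ge0// ler_norml => /andP[_ +].
  by move=> ?; lra.
move=> h [mh hL hE]; exists (fun x => h x - L); split.
- exact: measurable_funB.
- by move=> x; have /andP[? ?] := hL x; rewrite ler_norml; apply/andP; split; lra.
move=> a b pa ab bq.
have mI : measurable (`]a, b]%classic : set R) by exact: measurable_itv.
have muI := lebesgue_measure_itvoc _ _ ab.
rewrite RintegralB//; last 2 first.
- apply: (@bounded_integrable _ h (L *+ 2)) => //; first by rewrite muI ltry.
  by move=> x; have /andP[h0 ?] := hL x; rewrite ger0_norm.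
- by apply: (@bounded_integrable _ _ `|L|) => //; rewrite muI ltry.
rewrite Rintegral_cst// [X in _ * fine X]muI /Rintegral hE//=; lra.
Qed.

End lipschitz_density.

(** * Strong differentiation of integrals at Lebesgue points *)

Section lebesgue_points.
Context {R : realType}.
Local Notation mu := (@lebesgue_measure R).

(** The left side is the integral of [h - h x] over []a, b]], which is dominated by the integral of
    its absolute value over a ball around [x] of comparable size. Both endpoints move freely, as the
    two-point definition of metric differentiability demands. *)
Lemma lebesgue_pt_strong_derivative (h : R -> R) (L x : R) :
  measurable_fun setT h -> (forall y, `|h y| <= L) -> lebesgue_pt h x ->
  forall e : R, 0 < e -> exists2 d : R, 0 < d & forall a b, a <= b ->
    `|a - x| < d -> `|b - x| < d ->
    `|\int[mu]_(y in `]a, b]) h y - h x * (b - a)| <= e * (`|a - x| + `|b - x|).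
Proof.
move=> mh hL /fine_cvgP[fin_davg /cvgrPdist_lt cvg_davg] e e0.
have [d /= d0 dP] : \forall r \near (0:R)^'+,
    davg h x r \is a fin_num /\ `|0 - fine (davg h x r)| < e / 4.
  near=> r; split; near: r => //.
  by apply: cvg_davg; rewrite divr_gt0.
exists (d / 4); first by rewrite divr_gt0.
move=> a b ab ad bd.
have [/eqP abx|abx] := eqVneq (`|a - x| + `|b - x|) 0.
  move: abx; rewrite paddr_eq0// !normr_eq0 !subr_eq0 => /andP[/eqP-> /eqP->].
  rewrite set_itv_ge ?bnd_simp ?ltxx// Rintegral_set0 !subrr mulr0 subrr.
  by rewrite !normr0 addr0 mulr0.
set s := `|a - x| + `|b - x|.
have s0 : 0 < s by rewrite lt_neqAle eq_sym abx addr_ge0.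
(* The factor 2 puts []a, b]] inside the open ball of radius [r]. That ball has measure [4 s], so a
   mean deviation below [e / 4] gives an integral below [e * s]. *)
pose r := s * 2.
have r0 : 0 < r by rewrite mulr_gt0.
have [rfin rlt] : davg h x r \is a fin_num /\ `|0 - fine (davg h x r)| < e / 4.
  apply: dP => //=; rewrite sub0r normrN gtr0_norm// /r /s; lra.
have mB : measurable (ball x r) by exact: measurable_ball.
have muB : mu (ball x r) = (r *+ 2)%:E by rewrite lebesgue_measure_ball// ltW.
have muI := lebesgue_measure_itvoc _ _ ab.
have mI : measurable (`]a, b]%classic : set R) by exact: measurable_itv.
have mg : measurable_fun setT (fun y => h y - h x) by exact: measurable_funB.
have gL y : `|h y - h x| <= L + L.
  by rewrite (le_trans (ler_normB _ _))// lerD.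
have ing A : measurable A -> (mu A < +oo)%E ->
    mu.-integrable A (EFin \o (fun y => h y - h x)).
  by move=> mA Aoo; exact: (@bounded_integrable _ _ _ (L + L)).
have -> : \int[mu]_(y in `]a, b]) h y - h x * (b - a) =
          \int[mu]_(y in `]a, b]) (h y - h x).
  rewrite RintegralB//; last 2 first.
  - by apply: (@bounded_integrable _ _ h L) => //; rewrite muI ltry.
  - apply: (@bounded_integrable _ _ (cst (h x)) `|h x|) => //.
    by rewrite muI ltry.
  by rewrite Rintegral_cst// [X in _ * fine X]muI.
have IB : `]a, b]%classic `<=` ball x r.
  move=> y /=; rewrite in_itv/= => /andP[ay yb].
  rewrite /ball/= distrC; apply: (@le_lt_trans _ _ s); last by rewrite /r; lra.
  rewrite /s ler_norml; apply/andP; split.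
    by have := ler_norm (x - a); rewrite distrC; have := normr_ge0 (b - x); lra.
  by have := ler_norm (b - x); have := normr_ge0 (a - x); lra.
have iB : mu.-integrable (ball x r) (EFin \o (fun y => h y - h x)).
  by apply: ing => //; rewrite muB ltry.
have iI : mu.-integrable `]a, b] (EFin \o (fun y => h y - h x)).
  by apply: ing => //; rewrite muI ltry.
apply: (le_trans (le_normr_Rintegral _ iI)) => //.
apply: (@le_trans _ _ (\int[mu]_(y in ball x r) `|h y - h x|)).
  apply: fine_le.
  - by apply: integrable_fin_num => //; exact: integrable_norm iI.
  - by apply: integrable_fin_num => //; exact: integrable_norm iB.
  apply: ge0_subset_integral => //.
  by apply/measurable_EFinP/measurableT_comp => //; exact: measurable_funS mg.
have dE : davg h x r =
    (((r *+ 2)^-1)%:E * (\int[mu]_(y in ball x r) `|h y - h x|)%R%:E)%E.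
  rewrite /davg /iavg muB inver gt_eqF ?mulrn_wgt0//; congr (_ * _)%E.
  rewrite /Rintegral fineK//.
  by apply: integrable_fin_num => //; exact: integrable_norm iB.
move: rlt; rewrite dE -EFinM/= sub0r normrN => /(le_lt_trans (ler_norm _)).
rewrite ltr_pdivrMl ?mulrn_wgt0// => /ltW/le_trans; apply.
by rewrite /r; lra.
Unshelve. all: by end_near. Qed.

End lebesgue_points.

(** * McShane extension of Lipschitz functions *)

Section mcshane.
Context {R : realType}.
Variables (A : set R) (u : R -> R) (L : R).
Hypotheses (L0 : 0 < L) (A0 : A !=set0).
Hypothesis uL : forall a b, A a -> A b -> `|u a - u b| <= L * `|a - b|.

(** This is the largest [L]-Lipschitz extension of [u] from [A]. For [u = 0] and [L = 1] it is the
    distance to [A]. *)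
Definition mcshane (t : R) : R := inf [set u a + L * `|t - a| | a in A].

Lemma has_inf_mcshane (t : R) : has_inf [set u a + L * `|t - a| | a in A].
Proof.
have [a0 Aa0] := A0.
split; first by exists (u a0 + L * `|t - a0|), a0.
exists (u a0 - L * `|t - a0|) => _ [a Aa <-].
have := uL _ _ Aa0 Aa; rewrite ler_norml => /andP[_].
have : L * `|a0 - a| <= L * (`|t - a0| + `|t - a|).
  rewrite ler_wpM2l ?(ltW L0)//.
  by rewrite (le_trans (ler_distD t _ _))// (distrC t a0).
by rewrite mulrDr => ? ?; lra.
Qed.

Lemma mcshane_le (t a : R) : A a -> mcshane t <= u a + L * `|t - a|.
Proof.
by move=> Aa; apply: ge_inf; [case: (has_inf_mcshane t)|exists a].
Qed.

Lemma mcshaneE (a : R) : A a -> mcshane a = u a.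
Proof.
move=> Aa; apply/eqP; rewrite eq_le; apply/andP; split.
  by have := mcshane_le a _ Aa; rewrite subrr normr0 mulr0 addr0.
apply: lb_le_inf; first by case: (has_inf_mcshane a).
move=> _ [b Ab <-].
by have := uL _ _ Aa Ab; rewrite ler_norml => /andP[_] ?; lra.
Qed.

Lemma mcshane_lipschitz (s t : R) : `|mcshane t - mcshane s| <= L * `|t - s|.
Proof.
have le_mcshane x y : mcshane x - L * `|x - y| <= mcshane y.
  apply: lb_le_inf; first by case: (has_inf_mcshane y).
  move=> _ [a Aa <-]; have := mcshane_le x _ Aa.
  have : L * `|x - a| <= L * (`|x - y| + `|y - a|).
    by rewrite ler_wpM2l ?(ltW L0)//; exact: ler_distD.
  by rewrite mulrDr => ? ?; lra.
rewrite ler_norml; apply/andP; split.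
  by have := le_mcshane s t; rewrite (distrC t s); lra.
by have := le_mcshane t s; lra.
Qed.

End mcshane.

(** * Approximation by points of a set, and dense sequences in it *)

Section ae_along_set.
Context {R : realType}.
Local Notation mu := (@lebesgue_measure R).

Lemma negligible_not_lebesgue_pt (h : R -> R) (L : R) :
  measurable_fun setT h -> (forall y, `|h y| <= L) ->
  mu.-negligible (~` lebesgue_pt h).
Proof.
move=> mh hL; apply: lebesgue_differentiation; split => // [|K _ cK].
  exact: openT.
have mK : measurable K by exact: compact_measurable.
have Koo : (mu K < +oo)%E by exact: compact_finite_measure.
by have /integrableP[] := @bounded_integrable _ _ _ _ mK Koo mh hL.
Qed.

(** This stands in for the Lebesgue density theorem on a possibly nonmeasurable [A]. The distance to
    [A] is differentiable at the Lebesgue points of its density; at such a point of [A] it attains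
    its minimum 0, so the derivative vanishes. *)
Lemma ae_set_approximation (A : set R) (p q : R) : A `<=` `]p, q[ ->
  exists2 M, mu.-negligible M & forall x, A x -> ~ M x ->
    forall e : R, 0 < e -> exists2 d : R, 0 < d & forall y, `|y - x| < d ->
      exists2 a, A a & `|y - a| <= e * `|y - x|.
Proof.
move=> Apq; have [->|/set0P A0] := eqVneq A set0.
  by exists set0 => //; exact: negligible_set0.
pose dist := mcshane A (fun=> 0) 1.
have zlip a b : A a -> A b -> `|(0:R) - 0| <= 1 * `|a - b|.
  by rewrite subrr normr0 mul1r.
have [h [mh hL hE]] := @lipschitz_density _ _ _ p q ltr01
  (@mcshane_lipschitz _ _ _ _ ltr01 A0 zlip).
exists (~` lebesgue_pt h); first exact: negligible_not_lebesgue_pt mh hL.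
move=> x Ax /contrapT xh e e0.
have distx : dist x = 0 by rewrite /dist (@mcshaneE _ _ _ _ ltr01 A0 zlip).
have dist_ge0 y : 0 <= dist y.
  apply: lb_le_inf; first by case: (@has_inf_mcshane _ _ _ _ ltr01 A0 zlip y).
  by move=> _ [a _ <-]; rewrite add0r mul1r.
have := Apq _ Ax; rewrite /= in_itv/= => /andP[px xq].
have strong := lebesgue_pt_strong_derivative _ _ _ mh hL xh.
have deriv e' : 0 < e' -> exists2 d, 0 < d & forall y, `|y - x| < d ->
    `|dist y - h x * (y - x)| <= e' * `|y - x|.
  move=> e'0; have [d d0 dP] := strong e' e'0.
  (* The last two terms keep [y] in []p, q[], where [h] represents the distance. *)
  exists (Num.min d (Num.min (x - p) (q - x))).
    by rewrite !lt_min d0 !subr_gt0 px xq.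
  move=> y; rewrite !lt_min => /and3P[yd].
  rewrite !ltr_norml => /andP[yp _] /andP[_ yq].
  have [xy|yx] := leP x y.
    have := dP _ _ xy; rewrite subrr normr0 add0r => /(_ d0 yd).
    by rewrite hE ?(ltW px)//; [rewrite -/(dist _) -/(dist _) distx subr0|lra].
  have := dP _ _ (ltW yx); rewrite subrr normr0 addr0 => /(_ yd d0).
  rewrite hE ?(ltW xq)//; [|lra|exact: ltW].
  rewrite -/(dist _) -/(dist _) distx -normrN.
  by congr (`|_| <= _); lra.
have hx0 : h x = 0.
  apply/eqP/negPn/negP => hx0.
  have hx20 : 0 < `|h x| / 2 by rewrite divr_gt0 ?normr_gt0.
  have [d d0 dP] := deriv _ hx20.
  (* On this side of [x] the linear term is [- |h x| * d / 2], while the error is at most half of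
     that; the distance at [y] would be negative. *)
  pose y := x - Num.sg (h x) * (d / 2).
  have yx : y - x = - (Num.sg (h x) * (d / 2)) by rewrite /y; lra.
  have nyx : `|y - x| = d / 2.
    by rewrite yx normrN normrM normr_sg hx0 mul1r gtr0_norm// divr_gt0.
  have := dP y; rewrite nyx => /(_ _)/wrap[]; first lra.
  have sgE : h x * (Num.sg (h x) * (d / 2)) = `|h x| * (d / 2).
    by rewrite mulrA (mulrC (h x)) -normrEsg.
  rewrite yx mulrN opprK sgE => /(le_trans (ler_norm _)).
  have := dist_ge0 y; have : 0 < `|h x| * d by rewrite mulr_gt0// normr_gt0.
  by move=> ? ? ?; lra.
have e20 : 0 < e / 2 by rewrite divr_gt0.
have [d d0 dP] := deriv _ e20; exists d => // y yd.
have [->|yx] := eqVneq y x; first by exists x => //; rewrite subrr normr0 mulr0.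
have := dP _ yd; rewrite hx0 mul0r subr0 => /(le_trans (ler_norm _)) disty.
have yx0 : 0 < e * `|y - x| by rewrite mulr_gt0// normr_gt0 subr_eq0.
(* The distance need not be attained, so half of the allowance [e * |y - x|] pays for a
   near-minimizer. *)
have [|_ [a Aa <-]] := @inf_adherent _ _ (e * `|y - x| / 2) _
  (@has_inf_mcshane _ _ _ _ ltr01 A0 zlip y); first by rewrite divr_gt0.
rewrite -/(mcshane _ _ _ _) -/(dist y) add0r mul1r => ya.
by exists a => //; lra.
Qed.

(** For each rational and each [n], a point of [A] within [1 / (n + 1)] of the rational is chosen if
    there is one. All other indices, including those that decode to no pair, fall back on points of
    [A] such as [a0], so the sequence never leaves [A]. *)
Lemma countable_dense_in (A : set R) : A !=set0 ->
  exists D : nat -> R, (forall k, A (D k)) /\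
    forall a e, A a -> 0 < e -> exists k, `|a - D k| < e.
Proof.
move=> [a0 Aa0].
pose P (i : rat * nat) (a : R) := A a /\ `|a - ratr i.1| < i.2.+1%:R^-1.
have /choice[g gP] i : exists y, A y /\ ((exists a, P i a) -> P i y).
  have [[a Pa]|nP] := pselect (exists a, P i a); first by exists a; case: (Pa).
  by exists a0.
exists (fun k => odflt a0 (omap g (unpickle k))); split.
  by move=> k; case: unpickle => //= i; case: (gP i).
move=> a e Aa e0.
pose n := Num.truncn (2 / e).
have ne : n.+1%:R^-1 < e / 2.
  by rewrite -[ltRHS]invf_div ltf_pV2 ?posrE ?divr_gt0// truncnS_gt.
have n0 : 0 < n.+1%:R^-1 :> R by rewrite invr_gt0.
have [r /[!in_itv]/= /andP[r1 r2]] :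
    exists r : rat, ratr r \in `]a - n.+1%:R^-1, a + n.+1%:R^-1[.
  by apply: rat_in_itvoo; move: n0; set w := _^-1; lra.
have Pa : P (r, n) a.
  by split => //=; rewrite distrC ltr_distl r1.
exists (pickle (r, n)); rewrite pickleK/=.
have [_ /(_ (ex_intro _ a Pa))[_ /= gr]] := gP (r, n).
apply: (le_lt_trans (ler_distD (ratr r) _ _)).
rewrite (distrC (ratr r)).
case: Pa => _ /= ar; move: ne gr ar; set w := _^-1.
by move=> ? ? ?; lra.
Qed.

End ae_along_set.

(** * Metric differentiability along a set on which the map is Lipschitz *)

Section kirchheim.
Context {R : realType} {X : normedModType R}.
Local Notation mu := (@lebesgue_measure R).

Lemma lipschitz_on_ae_metric_differentiable (A : set R) (p q L : R)
    (f : R -> X) :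
  0 < L -> A `<=` `]p, q[ ->
  (forall a b, A a -> A b -> `|f a - f b| <= L * `|a - b|) ->
  exists2 M, mu.-negligible M & forall x, A x -> ~ M x ->
    exists2 l : R, 0 <= l & forall e : R, 0 < e -> exists2 d : R, 0 < d &
      forall a b, A a -> A b -> `|a - x| < d -> `|b - x| < d ->
      `| `|f a - f b| - l * `|a - b| | <= e * (`|a - x| + `|b - x|).
Proof.
move=> L0 Apq fL; have [->|/set0P A0] := eqVneq A set0.
  by exists set0 => //; exact: negligible_set0.
have [D [AD Ddense]] := countable_dense_in _ A0.
pose u k a := `|f a - f (D k)|.
have uL k a b : A a -> A b -> `|u k a - u k b| <= L * `|a - b|.
  move=> Aa Ab; apply: (le_trans _ (fL _ _ Aa Ab)).
  by rewrite (le_trans (ler_dist_dist _ _))// opprB addrA subrK.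
pose phi k := mcshane A (u k) L.
have phiE k a : A a -> phi k a = u k a.
  by move=> Aa; rewrite /phi (@mcshaneE _ _ _ _ L0 A0 (uL k)).
have /choice[h hP] k := @lipschitz_density _ (phi k) L p q L0
  (@mcshane_lipschitz _ _ _ _ L0 A0 (uL k)).
have mh k : measurable_fun setT (h k) by have [] := hP k.
have hL k x : `|h k x| <= L by have [_ + _] := hP k.
have hE k a b : A a -> A b -> a <= b ->
    \int[mu]_(x in `]a, b]) h k x = u k b - u k a.
  move=> Aa Ab ab; have [_ _ ->//] := hP k.
  - by rewrite !phiE.
  - by have /=/[!in_itv]/= /andP[/ltW] := Apq _ Aa.
  - by have /=/[!in_itv]/= /andP[_ /ltW] := Apq _ Ab.
pose m x := sups (fun k => `|h k x|) 0.
have ub_h x : has_ubound (range (fun k => `|h k x|)).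
  by exists L => _ [k _ <-].
have ne_h x : [set `|h k x| | k in [set n | (0 <= n)%N] ] !=set0.
  by exists `|h 0 x|, 0.
have m_ge k x : `|h k x| <= m x.
  apply: ub_le_sup; last by exists k.
  by exists L => _ [i _ <-].
have m_le x : m x <= L.
  by apply: ge_sup => [|_ [k _ <-]//]; exact: ne_h.
have m_ge0 x : 0 <= m x by apply: le_trans (m_ge 0 x).
have m_norm x : `|m x| <= L by rewrite ger0_norm.
have mm : measurable_fun setT m.
  apply: measurable_fun_sups => // k.
  exact: measurableT_comp.
exists (\bigcup_k (~` lebesgue_pt (h k)) `|` ~` lebesgue_pt m).
  apply: negligibleU; last exact: negligible_not_lebesgue_pt mm m_norm.
  apply: negligible_bigcup => k.
  exact: negligible_not_lebesgue_pt (mh k) (hL k).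
move=> x Ax /not_orP[hx /contrapT mx].
have {}hx k : lebesgue_pt (h k) x.
  by apply: contrapT => khx; apply: hx; exists k.
exists (m x) => // e e0.
have e20 : 0 < e / 2 by rewrite divr_gt0.
(* The density [m] gives the upper estimate with error [e]. The lower one uses a single [k] with
   [|h k x|] above [m x - e / 2], and loses [e / 2] once by this choice and once by differentiating
   the integral of [h k]. *)
have [d1 d10 d1P] := lebesgue_pt_strong_derivative _ _ _ mm m_norm mx _ e0.
have [_ [k _ <-] hkx] : exists2 y, [set `|h k x| | k in [set n | (0 <= n)%N] ] y
    & m x - e / 2 < y.
  apply: sup_adherent => //; split; first exact: ne_h.
  by exists L => _ [i _ <-].
have [d2 d20 d2P] :=
  lebesgue_pt_strong_derivative _ _ _ (mh k) (hL k) (hx k) _ e20.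
exists (Num.min d1 d2); first by rewrite lt_min d10.
move=> a b; wlog ab : a b / a <= b.
  move=> wlg Aa Ab ad bd; have [ab|/ltW ba] := leP a b; first exact: wlg.
  by rewrite (distrC (f a)) (distrC a b) (addrC `|a - x|); exact: wlg.
move=> Aa Ab; rewrite !lt_min => /andP[ad1 ad2] /andP[bd1 bd2].
rewrite (distrC a b) (ger0_norm (_ : 0 <= b - a)) ?subr_ge0//.
have muI : (mu `]a, b] < +oo)%E by rewrite lebesgue_measure_itvoc// ltry.
have mI : measurable (`]a, b]%classic : set R) by exact: measurable_itv.
(* For [D i] close to [b], [|f a - f b|] is at most [u i a + u i b], which exceeds [u i a - u i b]
   only by [2 * u i b], at most [r]; that difference is an integral of [h i]. *)
have upper : `|f a - f b| <= \int[mu]_(y in `]a, b]) m y.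
  apply/ler_addgt0Pr => r r0.
  have r2L : 0 < r / (2 * L) by rewrite divr_gt0// mulr_gt0.
  have [i bi] := Ddense _ _ Ab r2L.
  have fbi : u i b <= r / 2.
    apply: (le_trans (fL _ _ Ab (AD i))).
    rewrite mulrC -ler_pdivlMr//; apply: (le_trans (ltW bi)).
    by rewrite invfM mulrA.
  have : `|u i b - u i a| <= \int[mu]_(y in `]a, b]) m y.
    rewrite -hE//; have ih := @bounded_integrable _ _ _ _ mI muI (mh i) (hL i).
    apply: (le_trans (le_normr_Rintegral _ ih)) => //.
    apply: le_Rintegral => //.
      exact: integrable_norm ih.
    exact: (@bounded_integrable _ _ _ L).
  rewrite distrC => /(le_trans (ler_norm _)) uiab.
  have : `|f a - f b| <= u i a + u i b by rewrite /u (distrC (f b)) ler_distD.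
  by lra.
have baxx : b - a <= `|a - x| + `|b - x|.
  have := ler_norm (b - x); have := ler_norm (x - a); rewrite (distrC x a).
  by lra.
have := d1P _ _ ab ad1 bd1; rewrite ler_norml => /andP[_ up].
rewrite ler_norml; apply/andP; split; last by rewrite (le_trans _ up)// lerD2r.
have := d2P _ _ ab ad2 bd2; rewrite hE// => low.
have : `|u k b - u k a| <= `|f a - f b|.
  by rewrite (le_trans (ler_dist_dist _ _))// opprB addrA subrK distrC.
have : `|h k x| * (b - a) <= `|u k b - u k a| + e / 2 * (`|a - x| + `|b - x|).
  rewrite -[leLHS](ger0_norm (_ : 0 <= _ * _)); last first.
    by rewrite mulr_ge0// subr_ge0.
  rewrite normrM normr_id -normrM -lerBlDl (le_trans _ low)//.
  by rewrite (distrC (_ - _) (_ * _)) lerB_dist.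
have : (m x - e / 2) * (b - a) <= `|h k x| * (b - a).
  by rewrite ler_wpM2r ?subr_ge0// ltW.
have : e / 2 * (b - a) <= e / 2 * (`|a - x| + `|b - x|).
  by rewrite ler_wpM2l// ltW.
by lra.
Qed.

End kirchheim.

(** * Transfer from a set to full neighbourhoods of its points *)

Section one_sided.
Context {R : realType} {X : normedModType R}.
Local Notation mu := (@lebesgue_measure R).
Implicit Types f : R -> X.

(** The two-point estimate already contains the unilateral limits: they are the case [z = x]. *)
Lemma metrically_differentiable_epsilon f (x l : R) :
  (forall e : R, 0 < e -> exists2 d : R, 0 < d &
    forall y z, `|y - x| < d -> `|z - x| < d ->
    `| `|f y - f z| - l * `|y - z| | <= e * (`|y - x| + `|z - x|)) ->
  metrically_differentiable f x.
Proof.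
move=> H; exists l; split.
  have sided (s : R) : `|s| = 1 ->
      (`|f (x + s * t) - f x| / t)%:E @[t --> 0^'+] --> l%:E.
    move=> s1; apply: cvg_EFin; first by near=> t.
    apply/cvgrPdist_le => /= e e0; have [d d0 dP] := H _ e0.
    near=> t.
    have t0 : 0 < t by [].
    have tE : `|x + s * t - x| = t.
      by rewrite addrAC subrr add0r normrM s1 mul1r gtr0_norm.
    have := dP (x + s * t) x; rewrite tE subrr normr0 addr0 => /(_ _ d0)/wrap[].
      by near: t; exact: nbhs_right_lt.
    rewrite distrC -(ler_pM2r (_ : 0 < t^-1)) ?invr_gt0// -mulrA divff ?gt_eqF//.
    rewrite mulr1 -[X in _ * X <= _ -> _](ger0_norm (_ : 0 <= t^-1));
      last by rewrite invr_ge0 (ltW t0).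
    by rewrite -normrM mulrBl mulfK ?gt_eqF.
  split.
    have := sided 1 (normr1 _).
    by under eq_fun do rewrite mul1r.
  have := sided (-1) (normrN1 _).
  by under eq_fun do rewrite mulN1r.
apply/eqoP => e e0; have [d d0 dP] := H _ e0.
near=> p; rewrite /= [X in _ <= _ * X]ger0_norm ?addr_ge0//; apply: dP.
  near: p; exists (ball x d, setT) => /=.
    by split; [exact: nbhsx_ballx|exact: filterT].
  by move=> [y z] [/= + _]; rewrite /ball/= distrC.
near: p; exists (setT, ball x d) => /=.
  by split; [exact: filterT|exact: nbhsx_ballx].
by move=> [y z] [/= _ +]; rewrite /ball/= distrC.
Unshelve. all: by end_near. Qed.

(* [s] is the side on which the difference quotients of [f] are controlled. *)
Lemma one_sided_lipschitz_ae (A : set R) (p q r L s : R) f :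
  0 < L -> `|s| = 1 -> A `<=` `]p, q[ -> q - p <= r ->
  (forall a y, A a -> 0 < s * (y - a) < r -> `|f y - f a| <= L * `|y - a|) ->
  exists2 M, mu.-negligible M &
    forall x, A x -> ~ M x -> metrically_differentiable f x.
Proof.
move=> L0 s1 Apq qpr fL.
have ss : s * s = 1 by rewrite -expr2 -real_normK ?num_real// s1 expr1n.
have normE y : `|s * y| = `|y| by rewrite normrM s1 mul1r.
(* Of two distinct points of [A], one lies on side [s] of the other, at distance below [r] because
   [A] sits in an interval of length at most [r]. *)
have fLA a b : A a -> A b -> `|f a - f b| <= L * `|a - b|.
  have AA y z : A y -> A z -> s * (y - z) < r.
    move=> /Apq/=/[!in_itv]/= /andP[? ?] /Apq/=/[!in_itv]/= /andP[? ?].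
    apply: (le_lt_trans (ler_norm _)); rewrite normE ltr_norml.
    by apply/andP; split; lra.
  move=> Aa Ab; have [sab|sba|/eqP sab] := ltgtP 0 (s * (a - b)).
  - by apply: fL => //; rewrite sab AA.
  - rewrite distrC (distrC a); apply: fL => //; rewrite AA// andbT.
    by rewrite -opprB mulrN oppr_gt0.
  - have : `|s * (a - b)| = 0 by rewrite -(eqP sab) normr0.
    rewrite normE => /eqP; rewrite normr_eq0 subr_eq0 => /eqP->.
    by rewrite !subrr !normr0 mulr0.
have [M1 M10 M1P] := ae_set_approximation _ _ _ Apq.
have [M2 M20 M2P] := lipschitz_on_ae_metric_differentiable _ _ _ _ _ L0 Apq fLA.
exists (M1 `|` M2); first exact: negligibleU.
move=> x Ax /not_orP[M1x M2x].
have [l l0 lP] := M2P _ Ax M2x.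
have r0 : 0 < r.
  by have /=/[!in_itv]/= /andP[? ?] := Apq _ Ax; lra.
(* Approximating [y' := y - s n |y - x|] by [A], rather than [y] itself, puts
   the approximating point on the side of [y] where [fL] applies. *)
have approx (n : R) : 0 < n -> n <= 1 -> exists2 d : R, 0 < d & forall y,
    `|y - x| < d -> exists2 a, A a &
      `|y - a| <= 2 * n * `|y - x| /\ `|f y - f a| <= L * `|y - a|.
  move=> n0 n1; have n40 : 0 < n / 4 by rewrite divr_gt0.
  have [d d0 dP] := M1P _ Ax M1x _ n40.
  exists (Num.min (d / 2) (r / 2)).
    by rewrite lt_min !divr_gt0.
  move=> y; rewrite lt_min => /andP[yd yr].
  have [->|yx] := eqVneq y x.
    by exists x => //; rewrite !subrr !normr0 !mulr0.
  have {}yx : 0 < `|y - x| by rewrite normr_gt0 subr_eq0.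
  set t := `|y - x| in yd yr yx *.
  have nt0 : 0 < n * t by rewrite mulr_gt0.
  have nt1 : n * t <= t by rewrite ler_piMl// ltW.
  pose y' := y - s * (n * t).
  have y'x : `|y' - x| <= 2 * t.
    have -> : y' - x = (y - x) - s * (n * t) by rewrite /y'; lra.
    by rewrite (le_trans (ler_normB _ _))// normE (gtr0_norm nt0) -/t; lra.
  (* As [y'] is within [2 t] of [x], the constant [n / 4] yields [a] within [n t / 2] of [y']. Hence
     [s * (y - a)] lies between [n t / 2] and [3 n t / 2]: positive, and below [r] since
     [t < r / 2]. *)
  have [|a Aa y'a] := dP y'; first by apply: (le_lt_trans y'x); lra.
  have {}y'a : `|s * (y' - a)| <= n * t / 2.
    rewrite normE (le_trans y'a)//.
    have : n / 4 * `|y' - x| <= n / 4 * (2 * t) by rewrite ler_wpM2l// ltW.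
    by lra.
  have sya : s * (y - a) = n * t + s * (y' - a).
    have -> : y - a = s * (n * t) + (y' - a) by rewrite /y'; lra.
    by rewrite mulrDr mulrA ss mul1r.
  move: y'a; rewrite ler_norml => /andP[y'a1 y'a2].
  have syan : 0 < s * (y - a) <= 2 * n * t by apply/andP; split; lra.
  have yaE : `|y - a| = s * (y - a).
    by rewrite -normE gtr0_norm//; case/andP: syan.
  exists a => //; split; first by rewrite yaE; case/andP: syan.
  by apply: fL => //; apply/andP; split; lra.
apply: (@metrically_differentiable_epsilon f x l) => e e0.
(* The approximants [a], [b] are at most 3 times as far from [x] as [y], [z], so [e / 6] costs half
   of [e]. The other half pays for replacing [y], [z] by [a], [b]: an error of at most
   [(L + l) * 2 n] times [|y - x| + |z - x|], which fixes [n]. *)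
have e60 : 0 < e / 6 by rewrite divr_gt0.
have [d1 d10 d1P] := lP _ e60.
have Ll0 : 0 < L + l by rewrite ltr_wpDr.
pose n := Num.min 1 (e / (4 * (L + l))).
have n0 : 0 < n by rewrite lt_min ltr01/= divr_gt0// mulr_gt0.
have n1 : n <= 1 by rewrite ge_min lexx.
have nL : (L + l) * n <= e / 4.
  rewrite mulrC -ler_pdivlMr// ge_min; apply/orP; right.
  by rewrite invfM mulrA.
have [d2 d20 d2P] := approx _ n0 n1.
exists (Num.min (d1 / 3) d2); first by rewrite lt_min d20 divr_gt0.
move=> y z; rewrite !lt_min => /andP[yd1 yd2] /andP[zd1 zd2].
have [a Aa [ya fya]] := d2P _ yd2.
have [b Ab [zb fzb]] := d2P _ zd2.
have near_x w c : `|w - c| <= 2 * n * `|w - x| -> `|c - x| <= 3 * `|w - x|.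
  move=> wc; apply: (le_trans (ler_distD w _ _)); rewrite (distrC c).
  have : n * `|w - x| <= `|w - x| by rewrite ler_piMl.
  by lra.
have ax := near_x _ _ ya; have bx := near_x _ _ zb.
have H : `| `|f a - f b| - l * `|a - b| | <= e / 6 * (`|a - x| + `|b - x|).
  by apply: d1P => //; [apply: (le_lt_trans ax)|apply: (le_lt_trans bx)]; lra.
have quad (V : normedModType R) (u v u' v' : V) :
    `| `|u - v| - `|u' - v'| | <= `|u - u'| + `|v - v'|.
  rewrite (le_trans (ler_dist_dist _ _))//.
  have -> : u - v - (u' - v') = (u - u') - (v - v').
    by rewrite !opprD !opprK addrACA.
  exact: ler_normB.
have Hf := quad _ (f y) (f z) (f a) (f b).
have Hr : `|l * (`|y - z| - `|a - b|)| <= l * (`|y - a| + `|z - b|).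
  by rewrite normrM (ger0_norm l0) ler_wpM2l//; exact: (quad R^o).
set S := `|y - x| + `|z - x|.
have S0 : 0 <= S by rewrite addr_ge0.
have yzn : (L + l) * (`|y - a| + `|z - b|) <= e / 2 * S.
  apply: (@le_trans _ _ ((L + l) * (2 * n * S))).
    by rewrite ler_wpM2l ?(ltW Ll0)// /S; lra.
  have : (L + l) * n * S <= e / 4 * S by rewrite ler_wpM2r.
  by lra.
have HS : e / 6 * (`|a - x| + `|b - x|) <= e / 6 * (3 * S).
  by rewrite ler_wpM2l ?(ltW e60)// /S; lra.
have -> : `|f y - f z| - l * `|y - z| = (`|f a - f b| - l * `|a - b|) +
   ((`|f y - f z| - `|f a - f b|) - l * (`|y - z| - `|a - b|)) by lra.
apply: (le_trans (ler_normD _ _)).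
have := ler_normB (`|f y - f z| - `|f a - f b|) (l * (`|y - z| - `|a - b|)).
by lra.
Qed.

End one_sided.

(** * Countable cover of the points with a finite upper metric derivative *)

Section covering.
Context {R : realType} {X : normedModType R}.
Local Notation mu := (@lebesgue_measure R).
Implicit Types f : R -> X.

(** One integer serves both as the bound and as the inverse of the radius, so that a single index
    enumerates the cases. *)
Lemma limf_esup_at_right_lty (g : R -> R) :
  (limf_esup (fun t => (g t)%:E) 0^'+ < +oo)%E ->
  exists n : nat, forall t, 0 < t < n.+1%:R^-1 -> g t <= n.+1%:R.
Proof.
move=> /ereal_inf_lt[_ [V [d /= d0 dV] <-] Voo].
pose C := fine (ereal_sup [set (g t)%:E | t in V]).
have gC t : V t -> g t <= `|C|.
  move=> Vt; have gV : ((g t)%:E <= ereal_sup [set (g t)%:E | t in V])%E.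
    by apply: ereal_sup_ubound; exists t.
  apply: (le_trans _ (ler_norm _)); rewrite -lee_fin /C fineK//.
  by rewrite fin_numElt Voo andbT (lt_le_trans _ gV)// ltNyr.
pose n := maxn (Num.truncn `|C|) (Num.truncn d^-1).
exists n => t /andP[t0 tn].
have trunc_le (y : R) k : (Num.truncn y <= k)%N -> y <= k.+1%:R.
  by move=> yk; rewrite (le_trans (ltW (truncnS_gt y)))// ler_nat.
apply: (le_trans (gC t _)); last by apply: trunc_le; exact: leq_maxl.
apply: dV => //=; rewrite sub0r normrN gtr0_norm// (lt_le_trans tn)//.
rewrite -[leRHS]invrK lef_pV2 ?posrE ?invr_gt0//.
by apply: trunc_le; exact: leq_maxr.
Qed.

Lemma ae_metrically_differentiable_side f (s : R) : `|s| = 1 ->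
  exists2 M, mu.-negligible M & forall x, ~ M x ->
    (limf_esup (fun t => (`|f (x + s * t) - f x| / t)%:E) 0^'+ < +oo)%E ->
    metrically_differentiable f x.
Proof.
move=> s1.
have ss : s * s = 1 by rewrite -expr2 -real_normK ?num_real// s1 expr1n.
pose P (n : nat) (x : R) := forall t, 0 < t < n.+1%:R^-1 ->
  `|f (x + s * t) - f x| / t <= n.+1%:R.
(* With this half-width the pieces, centred at rationals, have length [1 / (n + 1)], exactly the
   range of [t] in which [P n] controls the quotients. *)
pose w (n : nat) : R := n.+1%:R^-1 / 2.
have w0 n : 0 < w n by rewrite divr_gt0 ?invr_gt0.
pose A (i : nat * rat) : set R :=
  P i.1 `&` `]ratr i.2 - w i.1, ratr i.2 + w i.1[.
have AM i : exists M, mu.-negligible M /\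
    forall x, A i x -> ~ M x -> metrically_differentiable f x.
  have [||||M M0 MP] := @one_sided_lipschitz_ae _ X (A i) (ratr i.2 - w i.1)
    (ratr i.2 + w i.1) i.1.+1%:R^-1 i.1.+1%:R s f _ s1; last by exists M.
  - by [].
  - exact: subIsetr.
  - by rewrite /w; set v := _^-1; lra.
  - move=> a y [Pa _] yar; have := Pa _ yar; case/andP: yar => ya0 _.
    rewrite mulrA ss mul1r (addrC a) subrK ler_pdivrMr//.
    by rewrite -[X in _ <= _ * X -> _](gtr0_norm ya0) normrM s1 mul1r.
have /choice[M MP] k : exists M, mu.-negligible M /\ forall i : nat * rat,
    unpickle k = Some i ->
    forall x, A i x -> ~ M x -> metrically_differentiable f x.
  case: (unpickle k) => [i|]; last first.
    by exists set0; split; [exact: negligible_set0|].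
  by have [M [M0 MP]] := AM i; exists M; split => // _ [<-].
exists (\bigcup_k M k); first by apply: negligible_bigcup => k; case: (MP k).
move=> x Mx /limf_esup_at_right_lty[n Pn].
have [c /[!in_itv]/= /andP[c1 c2]] :
    exists c : rat, ratr c \in `]x - w n, x + w n[.
  by apply: rat_in_itvoo; have := w0 n; lra.
have [_ MPk] := MP (pickle (n, c)).
apply: (MPk (n, c)); first by rewrite pickleK.
  by split => //=; rewrite in_itv/=; apply/andP; split; lra.
by move=> Mkx; apply: Mx; exists (pickle (n, c)).
Qed.

End covering.

Theorem corollary3p7 (R : realType) (X : completeNormedModType R) (f : R -> X) :
  exists M : set R,
    (@lebesgue_measure R).-negligible M /\
    forall x : R, ~ M x ->
      (Order.min (mD_left f x) (mD_right f x) < +oo)%E ->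
      metrically_differentiable f x.
Proof.
have [M1 M10 M1P] := @ae_metrically_differentiable_side _ X f (-1) (normrN1 _).
have [M2 M20 M2P] := @ae_metrically_differentiable_side _ X f 1 (normr1 _).
exists (M1 `|` M2); split; first exact: negligibleU.
move=> x /not_orP[M1x M2x]; rewrite gt_min => /orP[|] mD.
  apply: M1P => //; under eq_fun do rewrite mulN1r; exact: mD.
by apply: M2P => //; under eq_fun do rewrite mul1r; exact: mD.
Qed.
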